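(* For each positive integer $n$, let $X_n$ be a random variable having Student's $t$-distribution with parameter $n$ (i.e. $n$ degrees of freedom), and let $F_n$ be its cumulative distribution function. For $y\in(0,\sqrt{6}/2)$ define $$n_0(y):=\min\left\{n\in\mathbb{Z},\ n\ge 3:\ y^2<\frac{3n^2-14n+16}{2n^2-6n+3}\right\}.$$ Then for every $y\in(0,\sqrt{6}/2)$, $$\inf_{n\ge 3}\mathbf{P}\left(|X_n-\mathbf{E}[X_n]|\ge y\sqrt{\mathrm{Var}(X_n)}\right)=2-2\max_{3\le n\le n_0(y)+1}F_n\left(y\sqrt{\frac{n}{n-2}}\right),$$ where $n$ ranges over integers in both the infimum and the maximum.
   Context: $\mathbf{P}$, $\mathbf{E}$ and $\mathrm{Var}$ denote probability, expectation and variance. The Student $t$-distribution with parameter $n$ has probability density function $$f_n(x)=\frac{\Gamma\left(\frac{n+1}{2}\right)}{\sqrt{n\pi}\,\Gamma\left(\frac{n}{2}\right)}\left(1+\frac{x^2}{n}\right)^{-\frac{n+1}{2}},\qquad x\in\mathbb{R},$$ and $F_n(x)=\int_{-\infty}^x f_n(t)\,dt$. For $n\ge 3$ one has $\mathbf{E}[X_n]=0$ and $\mathrm{Var}(X_n)=\frac{n}{n-2}$. *)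

(* Defs.v *)
From HB Require Import structures.
From mathcomp Require Import all_boot all_order all_algebra.
From mathcomp Require Import all_classical all_reals all_analysis.
From mathcomp Require Import ring lra.

Set Implicit Arguments.
Unset Strict Implicit.
Unset Printing Implicit Defensive.

Import Order.TTheory GRing.Theory Num.Theory.
Import numFieldNormedType.Exports.

Local Open Scope classical_set_scope.
Local Open Scope ring_scope.

(* Euler's integral; it is the Gamma function for s > 0 only. *)
Definition Gamma {R : realType} (s : R) : R :=
  \int[lebesgue_measure]_(t in `]0, +oo[) (t `^ (s - 1) * expR (- t)).

Definition student_pdf {R : realType} (n : nat) (x : R) : R :=
  Gamma (n.+1%:R / 2) / (Num.sqrt (n%:R * pi) * Gamma (n%:R / 2)) *
  (1 + x ^+ 2 / n%:R) `^ (- (n.+1%:R / 2)).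

Definition student_cdf {R : realType} (n : nat) (x : R) : R :=
  \int[lebesgue_measure]_(t in `]-oo, x]) student_pdf n t.

Definition has_student_distribution {R : realType} {d : measure_display}
    {T : measurableType d} (P : probability T R) (X : {RV P >-> R})
    (n : nat) : Prop :=
  forall A : set R, measurable A ->
    distribution P X A =
    (\int[lebesgue_measure]_(x in A) (student_pdf n x)%:E)%E.

Definition n0_pred {R : realType} (y : R) : pred nat := fun n =>
  (3 <= n)%N &&
  (y ^+ 2 < (3 * n%:R ^+ 2 - 14 * n%:R + 16) / (2 * n%:R ^+ 2 - 6 * n%:R + 3)).

Lemma n0_pred_ex {R : realType} (y : R) :
  0 < y < Num.sqrt 6 / 2 -> exists n, n0_pred y n.
Proof.
move=> /andP[y0 ylt].
have s6 : Num.sqrt (6 : R) ^+ 2 = 6 by rewrite sqr_sqrtr.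
have y2 : y ^+ 2 < 3 / 2 by have := sqrtr_ge0 (6 : R); nra.
pose e := 3 / 2 - y ^+ 2.
have e0 : 0 < e by rewrite /e; lra.
have [m Hm] : exists m : nat, 15 / e < m%:R.
  exists (Num.bound (15 / e)); apply: archi_boundP.
  by rewrite divr_ge0 // ltW.
exists (m + 3)%N; rewrite /n0_pred leq_addl /=.
have m0 : 0 <= m%:R :> R by [].
move: Hm; rewrite ltr_pdivrMr // => Hm.
rewrite natrD; set x := m%:R in Hm m0 *.
have D0 : 0 < 2 * (x + 3) ^+ 2 - 6 * (x + 3) + 3 by nra.
rewrite ltr_pdivlMr //.
have -> : y ^+ 2 = 3 / 2 - e by rewrite /e; lra.
by nra.
Qed.

Definition n0 {R : realType} (y : R) (hy : 0 < y < Num.sqrt 6 / 2) : nat :=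
  ex_minn (n0_pred_ex hy).

(* Maximum of F over a <= n <= b, meaningful when a <= b; the default value
   F a of the big operator is then itself one of the terms. *)
Definition max_nat {R : realType} (a b : nat) (F : nat -> R) : R :=
  \big[Num.max/F a]_(a <= n < b.+1) F n.

(* Main.v *)
Require Import Defs.
From HB Require Import structures.
From mathcomp Require Import all_boot all_order all_algebra.
From mathcomp Require Import all_classical all_reals all_analysis.
From mathcomp Require Import measurable_realfun.
From mathcomp Require Import ring lra.

Set Implicit Arguments.
Unset Strict Implicit.
Unset Printing Implicit Defensive.

Import Order.TTheory GRing.Theory Num.Theory.
Import numFieldNormedType.Exports.

Local Open Scope classical_set_scope.
Local Open Scope ring_scope.

(** Write G n for F_n(y sqrt(n/(n-2))), the value at y of the distribution
    function of X_n rescaled to unit variance. As X_n is symmetric, has mean 0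
    and variance n/(n-2), the probability in the statement is 2 - 2 G n, and the
    claim is that G, over all n >= 3, attains its maximum at some n <= n0 + 1.
    This holds because G (n+2) <= G n for every n >= n0 ([n0_threshold],
    [standardized_student_cdf_add2]): descending in steps of two, any index
    beyond n0 + 1 leads to n0 or n0 + 1 without decreasing G.

    To compare n with n+2, put every distribution on the scale t = x / sqrt n,
    where the density is a constant b_n times (1 + t^2)^(-(n+1)/2), the kernel
    w_n. Integration by parts ties w_(n+2) to w_n and gives the exact recurrence
    F_(n+2)(sqrt(n+2) t) = F_n(sqrt n t) + (b_n / n) t w_n(t)
    ([student_cdf_add2]). The rescaled argument is s = y / sqrt(n-2) for n and
    t = y / sqrt n for n+2, so G (n+2) <= G n says that the gain (b_n/n) t w_n(t)
    is at most the mass of F_n between t and s. As w_n decreases, this mass is at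
    least b_n w_n(s) (s - t), and it remains to prove the elementary inequality
    t w_n(t) / n <= w_n(s) (s - t) ([student_kernel_gain]). It follows from
    Bernoulli's inequality for w_n(s) / w_n(t) and from
    sqrt(n/(n-2)) - 1 >= 2 / (2n-3), provided that y^2 <= 3(n-2)/(2n-1). The
    fraction defining n0 lies below 3(n-2)/(2n-1), which increases with n, so the
    proviso holds from n0 on.

    Gamma is never evaluated: the normalising constant is controlled only by the
    total mass of each density being 1, which is part of the hypothesis that X_n
    has that density. The variance comes from an explicit primitive, which involves
    the distribution function itself. *)

(** * Integration against a measure with a density *)

Section MeasureWithDensity.
Context {d : measure_display} {T : measurableType d} {R : realType}
  (mu : {sigma_finite_measure set T -> \bar R})
  (nu : {finite_measure set T -> \bar R}) (f : T -> \bar R).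
Hypothesis f_ge0 : forall x, (0 <= f x)%E.
Hypothesis mf : measurable_fun setT f.
Hypothesis nuE : forall A, measurable A -> nu A = (\int[mu]_(x in A) f x)%E.

(** By uniqueness of the Radon-Nikodym derivative, f is almost everywhere equal to
    the derivative of nu, for which the change of variables holds. *)
Lemma ge0_integral_density (g : T -> \bar R) :
  (forall x, (0 <= g x)%E) -> measurable_fun setT g ->
  (\int[nu]_x g x = \int[mu]_x (g x * f x))%E.
Proof.
move=> g0 mg.
have numu : nu `<< mu.
  apply/null_content_dominatesP => A mA muA0.
  rewrite nuE //; apply: null_set_integral => //.
  exact: measurable_funTS.
rewrite -(Radon_Nikodym_SigmaFinite.change_of_variables numu g0 measurableT mg).
have fi := Radon_Nikodym_SigmaFinite.f_integrable numu.
apply: ae_eq_integral => //.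
- by apply: emeasurable_funM => //; exact: measurable_int fi.
- exact: emeasurable_funM.
- apply: ae_eqe_mul2l; apply: integral_ae_eq => //.
  move=> E _ mE.
  by rewrite -nuE // -Radon_Nikodym_SigmaFinite.f_integral.
Qed.

End MeasureWithDensity.

(** * The Student density *)

Section StudentDensity.
Context {R : realType}.
Implicit Types (n : nat) (x y : R).

Lemma Gamma_ge0 (s : R) : 0 <= Gamma s.
Proof. by apply: Rintegral_ge0 => t _; rewrite mulr_ge0 ?powR_ge0 ?expR_ge0. Qed.

Lemma student_base_gt0 n x : 0 < 1 + x ^+ 2 / n%:R.
Proof. by rewrite ltr_pwDl // divr_ge0 ?sqr_ge0. Qed.

(** The value at 0 stands for the normalising constant from here on. *)
Lemma student_pdfE n x :
  student_pdf n x = student_pdf n 0 * (1 + x ^+ 2 / n%:R) `^ (- (n.+1%:R / 2)).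
Proof. by rewrite /student_pdf expr0n mul0r addr0 powR1 mulr1. Qed.

Lemma student_pdf_ge0 n x : 0 <= student_pdf n x.
Proof.
by rewrite mulr_ge0 ?powR_ge0 // divr_ge0 ?mulr_ge0 ?sqrtr_ge0 ?Gamma_ge0.
Qed.

Lemma student_pdfN n x : student_pdf n (- x) = student_pdf n x.
Proof. by rewrite /student_pdf sqrrN. Qed.

Lemma is_derive_base (a x : R) :
  is_derive x 1 (fun z : R => 1 + z ^+ 2 / a) (2 * x / a).
Proof.
have -> : (fun z : R => 1 + z ^+ 2 / a) = cst 1 + a^-1 \*: (@id R ^+ 2).
  by apply/funext => z; rewrite [in RHS]/= fctE /= exprfctE mulrC.
apply: is_derive_eq.
by rewrite add0r /GRing.scale /= expr1; ring.
Qed.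

Lemma is_derive_powR_base (a p x : R) : 0 < 1 + x ^+ 2 / a ->
  is_derive x 1 (fun z : R => (1 + z ^+ 2 / a) `^ p)
    (2 * p * x / a * (1 + x ^+ 2 / a) `^ p / (1 + x ^+ 2 / a)).
Proof.
move=> b0.
have := @is_derive1_comp _ (@powR R ^~ p) (fun z : R => 1 + z ^+ 2 / a) _ _ _
  (is_derive1_powR p b0) (is_derive_base a x).
move=> /is_derive_eq; apply.
rewrite powRB; last by rewrite (gt_eqF b0) implybT.
rewrite powRr1 ?(ltW b0) //.
ring.
Qed.

(** Since 1 + x^2/a is at least 1, the exponent may be taken to be -1, and
    x / (1 + x^2/a) <= a / x. *)
Lemma mulr_powR_base_cvg0 (a p : R) : 0 < a -> 1 <= p ->
  x * (1 + x ^+ 2 / a) `^ (- p) @[x --> +oo] --> (0 : R).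
Proof.
move=> a0 p1.
apply: (@squeeze_cvgr _ _ _ _ (cst 0) (fun x => a * x^-1)).
- near=> x.
  have x0 : 0 < x by near: x; exact: nbhs_pinfty_gt.
  have b1 : 1 <= 1 + x ^+ 2 / a by rewrite lerDl divr_ge0 ?sqr_ge0 ?ltW.
  have b0 : 0 < 1 + x ^+ 2 / a by rewrite (lt_le_trans ltr01).
  rewrite /= mulr_ge0 ?powR_ge0 ?(ltW x0) //=.
  have hp : (1 + x ^+ 2 / a) `^ (- p) <= (1 + x ^+ 2 / a)^-1.
    by rewrite -(powR_inv1 (ltW b0)) ler_powR // lerN2.
  apply: (@le_trans _ _ (x / (1 + x ^+ 2 / a))); first by rewrite ler_wpM2l // ltW.
  rewrite ler_pdivrMr // mulrAC ler_pdivlMr //.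
  have -> : a * (1 + x ^+ 2 / a) = a + x ^+ 2 by field; rewrite gt_eqF.
  by rewrite -expr2 lerDr ltW.
- exact: cvg_cst.
- rewrite -[X in _ --> X](mulr0 a); apply: cvgM; first exact: cvg_cst.
  apply/gtr0_cvgV0; last exact: cvg_id.
  by near=> x; near: x; exact: nbhs_pinfty_gt.
Unshelve. all: by end_near. Qed.

Lemma is_derive_student_pdf n x : (0 < n)%N ->
  is_derive x 1 (student_pdf n)
    (- (n.+1%:R / n%:R) * x * student_pdf n x / (1 + x ^+ 2 / n%:R)).
Proof.
move=> n0; have b0 := student_base_gt0 n x.
have h := is_derive_powR_base (- (n.+1%:R / 2)) b0.
have -> : student_pdf n =
    student_pdf n 0 \*: (fun z : R => (1 + z ^+ 2 / n%:R) `^ (- (n.+1%:R / 2))).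
  by apply/funext => z; rewrite student_pdfE.
apply: is_derive_eq.
rewrite /= /GRing.scale /=.
set w := _ `^ _; set b := 1 + _.
have b1 : b != 0 by rewrite gt_eqF.
have n1 : n%:R != 0 :> R by rewrite pnatr_eq0 -lt0n.
by field; rewrite n1 b1.
Qed.

Lemma continuous_student_pdf n : (0 < n)%N -> continuous (@student_pdf R n).
Proof.
move=> n0 x; apply: differentiable_continuous; apply/derivable1_diffP.
by apply: ex_derive; exact: is_derive_student_pdf.
Qed.

Lemma measurable_student_pdf n : (0 < n)%N ->
  measurable_fun [set: R] (student_pdf n).
Proof. by move=> n0; apply: continuous_measurable_fun; exact: continuous_student_pdf. Qed.

End StudentDensity.

(** * The Student distribution function *)

Section StudentCdf.
Context {R : realType} {d : measure_display} {T : measurableType d}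
  (P : probability T R) (X : {RV P >-> R}) (n : nat).
Hypothesis n_gt0 : (0 < n)%N.
Hypothesis hX : has_student_distribution X n.
Local Notation mu := (@lebesgue_measure R).

Lemma integral_student_pdf : (\int[mu]_x (student_pdf n x)%:E = 1)%E.
Proof. by rewrite -hX //; exact: probability_setT. Qed.

Lemma integrable_student_pdf : mu.-integrable setT (EFin \o student_pdf n).
Proof.
apply/integrableP; split.
  by apply/measurable_EFinP; exact: measurable_student_pdf.
under eq_integral => x _ do rewrite /= ger0_norm ?student_pdf_ge0 //.
by rewrite integral_student_pdf ltry.
Qed.

Lemma student_cdfE x : (student_cdf n x)%:E = cdf X x.
Proof.
by rewrite /cdf /student_cdf /Rintegral -hX ?fineK // fin_num_measure.
Qed.

Lemma student_cdf_cvgy : student_cdf n x @[x --> +oo] --> (1 : R).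
Proof.
have -> : student_cdf n = fine \o cdf X.
  by apply/funext => x; rewrite /= -student_cdfE.
by apply: fine_cvg; exact: cvg_cdfy1.
Qed.

Lemma student_cdf_cvgNy : student_cdf n x @[x --> -oo] --> (0 : R).
Proof.
have -> : student_cdf n = fine \o cdf X.
  by apply/funext => x; rewrite /= -student_cdfE.
by apply: fine_cvg; exact: cvg_cdfNy0.
Qed.

Lemma is_derive_student_cdf (x : R) :
  is_derive x 1 (student_cdf n) (student_pdf n x).
Proof.
have x1 : x < x + 1 by rewrite ltrDl.
have h1 : mu.-integrable [set` Interval -oo%O (BRight (x + 1))] (EFin \o student_pdf n).
  by apply: integrableS integrable_student_pdf.
have [||h2 h3] := continuous_FTC1 x1 h1 (x := x).
- by rewrite ltNyr.
- exact: continuous_student_pdf.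
rewrite -/(student_cdf n) in h2 h3.
apply: DeriveDef; first exact: h2.
by rewrite -derive1E; exact: h3.
Qed.

(** The density is even, so F(x) + F(-x) has zero derivative; its value is read
    off at infinity. *)
Lemma student_cdfN x : student_cdf n (- x) = 1 - student_cdf n x :> R.
Proof.
pose h (z : R) := student_cdf n z + student_cdf n (- z).
have hd (z : R) : is_derive z 1 h 0.
  have -> : h = student_cdf n + (student_cdf n \o -%R) by [].
  have h1 := is_derive_student_cdf z.
  have h2 := is_derive1_comp (is_derive_student_cdf (- z)) (is_deriveNid z 1).
  apply: (is_derive_eq (is_deriveD h1 h2)).
  by rewrite student_pdfN mulrN1 subrr.
have hc z : h z = h 0 by apply: is_derive_0_is_cst.
have hl : h z @[z --> +oo] --> (1 + 0 : R).
  apply: cvgD; first exact: student_cdf_cvgy.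
  exact: (proj1 (cvgNy_compNP _ _) student_cdf_cvgNy).
have h01 : h 0 = 1.
  rewrite -[RHS]addr0; apply: (cvg_unique _ _ hl) => //.
  have -> : h = cst (h 0) by apply/funext.
  exact: cvg_cst.
by rewrite -h01 -(hc x) /h addrC addKr.
Qed.

Lemma student_cdf0 : student_cdf n 0 = 2^-1 :> R.
Proof. have := student_cdfN 0; rewrite oppr0; lra. Qed.

Lemma student_tail (s : R) :
  distribution P X `[s, +oo[ = (1 - student_cdf n s)%:E.
Proof.
rewrite hX //.
rewrite (@ge0_continuous_FTC2y _ (student_pdf n) (student_cdf n) s 1) //.
- by move=> x _; exact: student_pdf_ge0.
- apply: continuous_subspaceT; exact: continuous_student_pdf.
- exact: student_cdf_cvgy.
- by move=> x _; apply: ex_derive; exact: is_derive_student_cdf.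
- apply: cvg_at_right_filter; apply: differentiable_continuous.
  by apply/derivable1_diffP; apply: ex_derive; exact: is_derive_student_cdf.
- by move=> x _; rewrite derive1E; apply: derive_val; exact: is_derive_student_cdf.
Qed.

Lemma student_two_sided_tail (s : R) : 0 < s ->
  P [set w | s <= `|X w|] = (2 - 2 * student_cdf n s)%:E.
Proof.
move=> s0.
have -> : [set w | s <= `|X w|] = X @^-1` (`]-oo, - s] `|` `[s, +oo[).
  apply/seteqP; split=> w /=; rewrite !in_itv /= andbT ler_normr.
    by case/orP=> h; [right|left; rewrite lerNr].
  by case=> h; rewrite ?h // lerNr h orbT.
rewrite -[LHS]/(distribution P X _) measureU //; last first.
  apply/seteqP; split=> // z /=; rewrite !in_itv /= andbT => -[h1 h2].
  suff : false by []. lra.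
transitivity (cdf X (- s) + distribution P X `[s, +oo[)%E; first by [].
rewrite student_tail -student_cdfE student_cdfN.
by rewrite -EFinD; congr EFin; ring.
Qed.

End StudentCdf.

(** * Mean and variance *)

Section Reflection.
Context {R : realType}.
Local Notation mu := (@lebesgue_measure R).

Lemma ge0_integral_reflection (h : R -> R) : (forall x, 0 <= h x) ->
  continuous h -> (\int[mu]_x (h x)%:E = \int[mu]_x (h (- x))%:E)%E.
Proof.
have halves (k : R -> R) : (forall x, 0 <= k x) -> continuous k ->
    (\int[mu]_x (k x)%:E =
      \int[mu]_(x in `[0%R, +oo[) (k (- x))%:E + \int[mu]_(x in `[0%R, +oo[) (k x)%:E)%E.
  move=> k0 ck.
  have mk : measurable_fun [set: R] (EFin \o k).
    by apply/measurable_EFinP; exact: continuous_measurable_fun.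
  rewrite -(setUv (`[0%R, +oo[%classic : set (measurableTypeR R))) ge0_integral_setU //; first last.
  - exact/disj_setPCl.
  - by move=> x _; rewrite lee_fin.
  - by rewrite setUv.
  - exact: measurableC.
  rewrite addeC; congr (_ + _)%E.
  rewrite setCitvr integral_itv_bndo_bndc; last exact: measurable_funTS.
  rewrite -{1}oppr0 ge0_integration_by_substitutionNy //.
  exact: continuous_subspaceT.
move=> h0 ch; rewrite halves // addeC (halves (h \o -%R)) //.
- by congr (_ + _)%E; apply: eq_integral => x _; rewrite /= opprK.
- by move=> x; exact: h0.
- move=> x; apply: continuous_comp; [exact: oppr_continuous|exact: ch].
Qed.

End Reflection.

Section Moments.
Context {R : realType} {d : measure_display} {T : measurableType d}
  (P : probability T R) (X : {RV P >-> R}) (n : nat).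
Hypothesis n_gt0 : (0 < n)%N.
Hypothesis hX : has_student_distribution X n.
Local Notation mu := (@lebesgue_measure R).

Lemma ge0_expectation_student (g : R -> R) :
  (forall x, 0 <= g x) -> measurable_fun setT g ->
  (\int[P]_w (g (X w))%:E = \int[mu]_x (g x * student_pdf n x)%:E)%E.
Proof.
move=> g0 mg.
(* The Lebesgue measure lives on R with the sigma-algebra generated by half-open
   intervals, the law of X on R with its default measurable structure. The
   measurable sets are the same but the types differ, whence the copy Y of X. *)
have mX : @measurable_fun _ _ T (measurableTypeR R) setT X.
  by move=> mT A mA; exact: (@measurable_funPT _ _ _ _ X mT A mA).
pose Y : {mfun T >-> measurableTypeR R} :=
  @mfun_Sub _ _ T (measurableTypeR R) X (mem_set mX).
have mgE : measurable_fun [set: measurableTypeR R] (EFin \o g).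
  exact/measurable_EFinP.
have g0E y : (0 <= (EFin \o g) y)%E by rewrite lee_fin.
transitivity (\int[distribution P Y]_y (EFin \o g) y)%E.
  by rewrite ge0_integral_distribution.
rewrite (@ge0_integral_density _ _ _ mu _ (EFin \o student_pdf n)) //.
by apply/measurable_EFinP; exact: measurable_student_pdf.
Qed.

(** Reflection exchanges the positive and the negative part of X, so that both have
    the same expectation a; the real part of a - a is 0 for every extended real a,
    infinite ones included. *)
Lemma fine_expectation_student : fine ('E_P[X])%E = 0.
Proof.
pose g (x : R) := Num.max x 0.
have cg : continuous g.
  by move=> x; apply: continuous_max; [exact: id|exact: cst_continuous].
have g0 x : 0 <= g x by rewrite le_max lexx orbT.
rewrite expectation_def integralE.
have -> : (\int[P]_w (fun w => (X w)%:E)^\+ w = \int[P]_w (g (X w))%:E)%E.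
  by apply: eq_integral => w _; rewrite funeposE EFin_max.
have -> : (\int[P]_w (fun w => (X w)%:E)^\- w = \int[P]_w ((g \o -%R) (X w))%:E)%E.
  by apply: eq_integral => w _; rewrite funenegE EFin_max.
have cgN : continuous (g \o -%R).
  by move=> x; apply: continuous_comp; [exact: oppr_continuous|exact: cg].
rewrite !ge0_expectation_student //; try exact: continuous_measurable_fun; last first.
  by move=> x; exact: g0.
rewrite ge0_integral_reflection.
- under eq_integral do rewrite student_pdfN.
  by rewrite /=; case: (integral _ _ _) => [r||] //=; rewrite subrr.
- by move=> x; rewrite mulr_ge0 ?student_pdf_ge0.
- by move=> x; apply: cvgM; [exact: cg|exact: continuous_student_pdf].
Qed.

(** The boundary term at infinity of the primitive below: the factor 1 + x^2/n
    leaves the exponent (n-1)/2, which is at least 1. *)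
Lemma student_moment_tail_cvg0 : (3 <= n)%N ->
  x * (1 + x ^+ 2 / n%:R) * student_pdf n x @[x --> +oo] --> (0 : R).
Proof.
move=> n3.
have -> : (fun x : R => x * (1 + x ^+ 2 / n%:R) * student_pdf n x) =
    (fun x => student_pdf n 0 *
      (x * (1 + x ^+ 2 / n%:R) `^ (- (n.+1%:R / 2 - 1)))).
  apply/funext => x; have b0 := student_base_gt0 n x.
  have -> : - (n.+1%:R / 2 - 1) = - (n.+1%:R / 2) + 1 :> R by ring.
  rewrite student_pdfE powRD; last by rewrite (gt_eqF b0) implybT.
  by rewrite powRr1 ?(ltW b0) //; ring.
rewrite -[X in _ --> X](mulr0 (student_pdf n 0)).
apply: cvgM; first exact: cvg_cst.
apply: mulr_powR_base_cvg0; first by rewrite ltr0n.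
by rewrite lerBrDr ler_pdivlMr // -[1 + 1]/(2%:R) -natrM ler_nat.
Qed.

Let k : R := n%:R / (n%:R - 2).
(** Differentiating x (1 + x^2/n)^(-(n-1)/2) gives the density times
    1 - (n-2) x^2/n; solving for x^2 times the density yields this primitive. *)
Let A (x : R) : R :=
  k * (student_cdf n x - x * (1 + x ^+ 2 / n%:R) * student_pdf n x).

Lemma is_derive_second_moment (x : R) : (3 <= n)%N ->
  is_derive x 1 A (x ^+ 2 * student_pdf n x).
Proof.
move=> n3.
have n0 : n%:R != 0 :> R by rewrite pnatr_eq0 -lt0n.
have n2 : n%:R - 2 != 0 :> R by rewrite gt_eqF // subr_gt0 ltr_nat.
have b0 : 1 + x ^+ 2 / n%:R != 0 by rewrite gt_eqF // student_base_gt0.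
have hF := is_derive_student_cdf n_gt0 hX x.
have hf := is_derive_student_pdf x n_gt0.
have hb := is_derive_base n%:R x.
have hz := is_derive_id x (1 : R).
have h := is_deriveZ k (is_deriveB hF (is_deriveM (is_deriveM hz hb) hf)).
apply: (is_derive_eq h).
rewrite /GRing.scale /= /k.
have -> : n.+1%:R = n%:R + 1 :> R by rewrite natr1.
rewrite mulrfctE.
have nx : n%:R + x ^+ 2 != 0.
  by rewrite gt_eqF // ltr_pwDl ?sqr_ge0 // ltr0n.
by field; rewrite n0 n2 nx.
Qed.

Lemma student_second_moment : (3 <= n)%N ->
  (\int[mu]_x (x ^+ 2 * student_pdf n x)%:E = k%:E)%E.
Proof.
move=> n3.
have cx2 : continuous (fun x : R => x ^+ 2 * student_pdf n x).
  move=> x; apply: cvgM; [exact: exprn_continuous|exact: continuous_student_pdf].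
have hA (x : R) : A z @[z --> x] --> A x.
  apply: differentiable_continuous; apply/derivable1_diffP.
  by apply: ex_derive; exact: is_derive_second_moment.
rewrite ge0_symfun_integralT //; last 2 first.
- by move=> x; rewrite mulr_ge0 ?sqr_ge0 ?student_pdf_ge0.
- by move=> x; rewrite /= sqrrN student_pdfN.
rewrite -set_itvcy (@ge0_continuous_FTC2y _ _ A 0 k).
- rewrite -EFinB -EFinM; congr EFin.
  by rewrite /A (student_cdf0 n_gt0 hX) !mul0r subr0; field.
- by move=> x _; rewrite mulr_ge0 ?sqr_ge0 ?student_pdf_ge0.
- exact: continuous_subspaceT.
- rewrite -[X in _ --> X]mulr1 -[X in _ --> k * X]subr0.
  apply: cvgM; [exact: cvg_cst|apply: cvgB].
    exact: student_cdf_cvgy hX.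
  exact: student_moment_tail_cvg0.
- by move=> x _; apply: ex_derive; exact: is_derive_second_moment.
- by apply: cvg_at_right_filter; exact: hA.
- by move=> x _; rewrite derive1E; apply: derive_val; exact: is_derive_second_moment.
Qed.

Lemma variance_student : (3 <= n)%N -> ('V_P[X])%E = k%:E.
Proof.
move=> n3; rewrite /variance covariance.unlock fine_expectation_student.
rewrite expectation.unlock -student_second_moment //.
rewrite -ge0_expectation_student; last 2 first.
- by move=> x; rewrite sqr_ge0.
- by apply: continuous_measurable_fun; exact: exprn_continuous.
by apply: eq_integral => w _; rewrite !fctE /= !subr0 expr2.
Qed.

End Moments.

(** * From n to n + 2 degrees of freedom *)

Section Kernel.
Context {R : realType}.
Implicit Types (n : nat) (t : R).

(** The Student density on the scale t = x / sqrt n, up to a constant. *)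
Definition student_kernel n t : R := (1 + t ^+ 2) `^ (- (n.+1%:R / 2)).

Lemma onep_sqr_gt0 t : 0 < 1 + t ^+ 2.
Proof. by rewrite ltr_pwDl ?sqr_ge0. Qed.

Lemma student_kernel_gt0 n t : 0 < student_kernel n t.
Proof. by rewrite powR_gt0 // onep_sqr_gt0. Qed.

Lemma student_kernel_add2 n t :
  student_kernel n.+2 t = student_kernel n t / (1 + t ^+ 2).
Proof.
rewrite /student_kernel.
have -> : - (n.+3%:R / 2) = - (n.+1%:R / 2) - 1 :> R.
  by rewrite -[n.+3]/(2 + n.+1)%N natrD; field.
rewrite powRB; last by rewrite (gt_eqF (onep_sqr_gt0 t)) implybT.
by rewrite powRr1 // ltW // onep_sqr_gt0.
Qed.

Lemma student_kernel_le n (s t : R) : 0 <= s -> s <= t ->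
  student_kernel n t <= student_kernel n s.
Proof.
move=> s0 st; rewrite /student_kernel !powRN lef_pV2 ?posrE ?powR_gt0 ?onep_sqr_gt0 //.
apply: ge0_ler_powR; rewrite ?nnegrE ?(ltW (onep_sqr_gt0 _)) //.
by rewrite lerD2l ler_sqr ?nnegrE // (le_trans s0).
Qed.

Lemma is_derive_student_kernel n t :
  is_derive t 1 (student_kernel n)
    (- n.+1%:R * t * student_kernel n t / (1 + t ^+ 2)).
Proof.
have h := @is_derive_powR_base R 1 (- (n.+1%:R / 2)) t.
rewrite !divr1 in h.
have -> : student_kernel n = fun z => (1 + z ^+ 2 / 1) `^ (- (n.+1%:R / 2)).
  by apply/funext => z; rewrite divr1.
apply: is_derive_eq; first exact: (h (onep_sqr_gt0 t)).
by rewrite divr1; have /gt_eqF/negbT := onep_sqr_gt0 t => b0; field.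
Qed.

Lemma mulr_student_kernel_cvg0 n : (0 < n)%N ->
  t * student_kernel n t @[t --> +oo] --> (0 : R).
Proof.
move=> n0.
have -> : (fun t => t * student_kernel n t) =
    fun t => t * (1 + t ^+ 2 / 1) `^ (- (n.+1%:R / 2)).
  by apply/funext => t; rewrite divr1.
apply: mulr_powR_base_cvg0 => //.
by rewrite ler_pdivlMr // mul1r ler_nat.
Qed.

End Kernel.

Section Scaled.
Context {R : realType} {d : measure_display} {T : measurableType d}
  (P : probability T R) (X : {RV P >-> R}) (n : nat).
Hypothesis n_gt0 : (0 < n)%N.
Hypothesis hX : has_student_distribution X n.
(** The constant in front of the kernel: the value at 0 of the density of
    X_n / sqrt n. *)
Definition student_peak (n : nat) : R := Num.sqrt n%:R * student_pdf n 0.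

Lemma student_pdf_scaled (t : R) :
  Num.sqrt n%:R * student_pdf n (Num.sqrt n%:R * t) =
  student_peak n * student_kernel n t.
Proof.
rewrite student_pdfE exprMn sqr_sqrtr ?ler0n // mulrA.
by rewrite [_ * t ^+ 2]mulrC mulfK // pnatr_eq0 -lt0n.
Qed.

(** If the density vanished at 0 it would vanish everywhere and have mass 0. *)
Lemma student_peak_gt0 : 0 < student_peak n.
Proof.
rewrite mulr_gt0 ?sqrtr_gt0 ?ltr0n // lt_neqAle student_pdf_ge0 andbT.
apply/eqP => p0; have := integral_student_pdf hX.
under eq_integral do rewrite student_pdfE -p0 mul0r.
by rewrite integral0 => /eqP; rewrite eqe eq_sym oner_eq0.
Qed.

Lemma is_derive_scaled_cdf (t : R) :
  is_derive t 1 (fun t => student_cdf n (Num.sqrt n%:R * t) : R)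
    (student_peak n * student_kernel n t).
Proof.
rewrite -student_pdf_scaled.
have hs : is_derive t 1 (fun t => Num.sqrt n%:R * t) (Num.sqrt n%:R : R).
  apply: (is_derive_eq (is_deriveZ (Num.sqrt n%:R) (is_derive_id t (1 : R)))).
  by rewrite /GRing.scale /= mulr1.
apply: (is_derive_eq (is_derive1_comp
  (is_derive_student_cdf n_gt0 hX (Num.sqrt n%:R * t)) hs)).
by rewrite mulrC.
Qed.

Lemma scaled_cdf_cvgy :
  student_cdf n (Num.sqrt n%:R * t) @[t --> +oo] --> (1 : R).
Proof.
apply: (cvg_comp _ _ _ (student_cdf_cvgy hX)).
have s0 : 0 < Num.sqrt n%:R :> R by rewrite sqrtr_gt0 ltr0n.
exact: (gt0_cvgMry s0 cvg_id).
Qed.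

(** Mean value theorem, with the kernel bounded below by its value at s. *)
Lemma scaled_cdf_increment (t s : R) : 0 <= t -> t <= s ->
  student_peak n * student_kernel n s * (s - t) <=
  student_cdf n (Num.sqrt n%:R * s) - student_cdf n (Num.sqrt n%:R * t).
Proof.
move=> t0 ts.
have [||c] := @MVT_segment R (fun t => student_cdf n (Num.sqrt n%:R * t))
  (fun t => student_peak n * student_kernel n t) t s ts.
- by move=> x _; exact: is_derive_scaled_cdf.
- apply: derivable_within_continuous => x _.
  by apply: ex_derive; exact: is_derive_scaled_cdf.
rewrite in_itv /= => /andP[tc cs] ->.
rewrite ler_wpM2r ?subr_ge0 // ler_wpM2l ?(ltW student_peak_gt0) //.
by rewrite student_kernel_le // (le_trans t0).
Qed.

End Scaled.

Section Recurrence.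
Context {R : realType} {d d' : measure_display}
  {T : measurableType d} {T' : measurableType d'}
  (P : probability T R) (P' : probability T' R)
  (X : {RV P >-> R}) (X' : {RV P' >-> R}) (n : nat).
Hypothesis n_gt0 : (0 < n)%N.
Hypothesis hX : has_student_distribution X n.
Hypothesis hX' : has_student_distribution X' n.+2.

(** The derivative of t w_n(t) is (n+1) w_(n+2)(t) - n w_n(t), so the combination D
    below is constant. Its value at 0, where both distribution functions equal
    1/2, is half its limit at infinity, where they tend to 1; hence both vanish,
    and the two normalising constants are related without evaluating them. *)
Lemma student_cdf_add2 (t : R) :
  student_cdf n.+2 (Num.sqrt n.+2%:R * t) =
  student_cdf n (Num.sqrt n%:R * t) +
  student_peak n / n%:R * t * student_kernel n t.
Proof.
pose F m (t : R) : R := student_cdf m (Num.sqrt m%:R * t).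
pose b := @student_peak R n; pose b' := @student_peak R n.+2.
have b0 : b != 0 by rewrite gt_eqF // (student_peak_gt0 n_gt0 hX).
have b'0 : b' != 0 by rewrite gt_eqF // (student_peak_gt0 _ hX').
have N0 : n%:R != 0 :> R by rewrite pnatr_eq0 -lt0n.
have N1 : n%:R + 1 != 0 :> R by rewrite natr1 pnatr_eq0.
pose D (t : R) := (n%:R + 1) / b' * F n.+2 t - n%:R / b * F n t -
  t * student_kernel n t.
have dD (z : R) : is_derive z 1 D 0.
  have h1 : is_derive z 1 (F n) (b * student_kernel n z).
    exact: (is_derive_scaled_cdf n_gt0 hX z).
  have h2 : is_derive z 1 (F n.+2) (b' * student_kernel n.+2 z).
    exact: (is_derive_scaled_cdf _ hX' z).
  have h3 := is_deriveM (is_derive_id z (1 : R)) (is_derive_student_kernel n z).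
  have h := is_deriveB (is_deriveB (is_deriveZ ((n%:R + 1) / b') h2)
    (is_deriveZ (n%:R / b) h1)) h3.
  apply: (is_derive_eq h).
  rewrite /GRing.scale /= student_kernel_add2 -natr1.
  have /gt_eqF/negbT := onep_sqr_gt0 z => z0.
  by field; rewrite b0 b'0 z0.
have D0 z : D z = D 0 by apply: is_derive_0_is_cst.
have F0 m (Y : R) : student_cdf m 0 = Y -> F m 0 = Y by rewrite /F mulr0.
have D0E : D 0 = ((n%:R + 1) / b' - n%:R / b) / 2.
  rewrite /D (F0 _ _ (student_cdf0 n_gt0 hX)) (F0 _ _ (student_cdf0 _ hX')) //.
  by rewrite mul0r subr0; field; rewrite b0 b'0.
have hl : D z @[z --> +oo] --> (n%:R + 1) / b' * 1 - n%:R / b * 1 - 0.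
  apply: cvgB; last exact: mulr_student_kernel_cvg0.
  apply: cvgB; apply: cvgM; try exact: cvg_cst.
    exact: (scaled_cdf_cvgy _ hX').
  exact: (scaled_cdf_cvgy n_gt0 hX).
(* D 0 = c / 2 and lim D = c for the same c, which must therefore be 0. *)
have hb : (n%:R + 1) / b' = n%:R / b.
  have : D 0 = (n%:R + 1) / b' * 1 - n%:R / b * 1 - 0.
    apply: (cvg_unique _ _ hl) => //.
    have -> : D = cst (D 0) by apply/funext.
    exact: cvg_cst.
  rewrite D0E; lra.
have := D0 t; rewrite D0E hb subrr mul0r /D hb => /eqP.
rewrite subr_eq0 -mulrBr => /eqP h.
rewrite -/(F n.+2 t) -/(F n t) -/b -mulrA -h.
by field; rewrite b0.
Qed.

End Recurrence.

(** * The elementary inequality *)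

Section Inequality.
Context {R : realType}.

Lemma powR_bernoulli (r p : R) : 0 < r <= 1 -> 1 <= p ->
  1 - p * (1 - r) <= r `^ p.
Proof.
move=> /andP[r0 r1] p1.
have [||c] := @MVT_segment R (@powR R ^~ p) (fun z => p * z `^ (p - 1)) r 1 r1.
- move=> z; rewrite in_itv /= => /andP[rz _].
  by apply: is_derive1_powR; rewrite (lt_trans r0).
- apply: derivable_within_continuous => z; rewrite in_itv /= => /andP[rz _].
  by apply: derivable_powR; rewrite in_itv /= andbT (lt_le_trans r0).
rewrite in_itv /= powR1 => /andP[rc c1] h.
have c0 : 0 <= c by rewrite (le_trans (ltW r0)).
have cp : c `^ (p - 1) <= 1 `^ (p - 1).
  by apply: ge0_ler_powR; rewrite ?nnegrE ?subr_ge0.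
rewrite powR1 in cp.
have : p * c `^ (p - 1) * (1 - r) <= p * (1 - r).
  rewrite ler_wpM2r ?subr_ge0 // -[leRHS]mulr1 ler_wpM2l //.
  by rewrite (le_trans ler01).
rewrite -h; lra.
Qed.

Lemma student_kernel_ratio (n : nat) (s t : R) :
  student_kernel n s =
  student_kernel n t * ((1 + t ^+ 2) / (1 + s ^+ 2)) `^ (n.+1%:R / 2).
Proof.
have s0 := onep_sqr_gt0 s; have t0 := onep_sqr_gt0 t.
rewrite /student_kernel !powRN powRM ?invr_ge0 ?(ltW s0) ?(ltW t0) //.
rewrite mulKf ?gt_eqF ?powR_gt0 //.
by rewrite -[in RHS](powR_inv1 (ltW s0)) -powRrM mulN1r powRN.
Qed.

(** Adding 1 to both sides and squaring: (2N-1)^2 (N-2) = (2N-3)^2 N - 2. *)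
Lemma sqrt_ratio_lower (N : R) : 3 <= N ->
  2 / (2 * N - 3) <= Num.sqrt N / Num.sqrt (N - 2) - 1.
Proof.
move=> N3.
have a0 : 0 < Num.sqrt N by rewrite sqrtr_gt0; lra.
have b0 : 0 < Num.sqrt (N - 2) by rewrite sqrtr_gt0; lra.
have a2 : Num.sqrt N ^+ 2 = N by rewrite sqr_sqrtr; lra.
have b2 : Num.sqrt (N - 2) ^+ 2 = N - 2 by rewrite sqr_sqrtr; lra.
set a := Num.sqrt N in a0 a2 *; set b := Num.sqrt (N - 2) in b0 b2 *.
have d0 : 0 < 2 * N - 3 by lra.
have h : (2 * N - 1) * b <= (2 * N - 3) * a.
  rewrite -ler_sqr ?nnegrE ?mulr_ge0 ?ltW //; last by lra.
  rewrite !exprMn a2 b2; lra.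
rewrite lerBrDr.
have -> : 2 / (2 * N - 3) + 1 = (2 * N - 1) / (2 * N - 3).
  by field; rewrite gt_eqF.
by rewrite ler_pdivrMr // mulrAC ler_pdivlMr // [leRHS]mulrC.
Qed.

(** Dividing by t w_n(t) leaves 1/n <= r^((n+1)/2) (sqrt(n/(n-2)) - 1), where
    r = (1 + t^2) / (1 + s^2). The last factor is at least 2 / (2n-3), so it is
    enough that r^((n+1)/2) be at least (2n-3) / (2n); after Bernoulli's
    inequality this is exactly the hypothesis on y. *)
Lemma student_kernel_gain (n : nat) (y : R) : (3 <= n)%N -> 0 < y ->
  y ^+ 2 * (2 * n%:R - 1) <= 3 * (n%:R - 2) ->
  let s := y / Num.sqrt (n%:R - 2) in let t := y / Num.sqrt n%:R in
  t / n%:R * student_kernel n t <= student_kernel n s * (s - t).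
Proof.
move=> n3 y0 hy /=.
set s := y / Num.sqrt (n%:R - 2); set t := y / Num.sqrt n%:R.
have N3 : 3 <= n%:R :> R by rewrite ler_nat.
have a0 : 0 < Num.sqrt (n%:R : R) by rewrite sqrtr_gt0; lra.
have b0 : 0 < Num.sqrt (n%:R - 2 : R) by rewrite sqrtr_gt0; lra.
have t0 : 0 < t by rewrite divr_gt0.
have sE : s - t = t * (Num.sqrt n%:R / Num.sqrt (n%:R - 2) - 1).
  by rewrite /s /t; field; rewrite !gt_eqF.
have s2 : s ^+ 2 = y ^+ 2 / (n%:R - 2).
  by rewrite exprMn exprVn sqr_sqrtr //; lra.
have t2 : t ^+ 2 = y ^+ 2 / n%:R by rewrite exprMn exprVn sqr_sqrtr.
rewrite (student_kernel_ratio n s t).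
set r := (1 + t ^+ 2) / (1 + s ^+ 2).
set Y := y ^+ 2 in hy s2 t2; have Y0 : 0 < Y by rewrite exprn_gt0.
have q0 := sqrt_ratio_lower N3.
set N : R := n%:R in N3 a0 b0 hy sE s2 t2 q0 *.
have NY : 0 < N * (N - 2 + Y) by nra.
have rE : r = 1 - 2 * Y / (N * (N - 2 + Y)).
  by rewrite /r s2 t2; field; rewrite !gt_eqF //; nra.
have r01 : 0 < r <= 1.
  rewrite divr_gt0 ?onep_sqr_gt0 //= rE lerBlDr lerDl.
  by rewrite divr_ge0 ?(ltW NY) //; lra.
have p1 : 1 <= n.+1%:R / 2 :> R.
  by rewrite ler_pdivlMr // mul1r ler_nat ltnS (leq_trans _ n3).
have hL := powR_bernoulli r01 p1.
have L : (2 * N - 3) / (2 * N) <= r `^ (n.+1%:R / 2).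
  apply: le_trans hL; rewrite rE -(natr1 n) -/N.
  rewrite ler_pdivrMr; last by lra.
  (* The difference has the hypothesis on y as its numerator. *)
  rewrite -subr_ge0.
  have -> : (1 - (N + 1) / 2 * (1 - (1 - 2 * Y / (N * (N - 2 + Y))))) * (2 * N)
     - (2 * N - 3) = (3 * (N - 2) - Y * (2 * N - 1)) / (N - 2 + Y).
    by field; rewrite !gt_eqF //; nra.
  by rewrite divr_ge0 ?subr_ge0 //; lra.
have w0 := student_kernel_gt0 n t.
rewrite sE [leLHS]mulrC -mulrA ler_pM2l // mulrCA ler_pM2l //.
apply: le_trans (ler_pM _ _ L q0); last 2 first.
- by rewrite divr_ge0 //; lra.
- by rewrite divr_ge0 //; lra.
rewrite le_eqVlt; apply/orP; left; apply/eqP; field.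
by rewrite !gt_eqF //; lra.
Qed.

End Inequality.

(** * The maximum *)

Section Step.
Context {R : realType} {d d' : measure_display}
  {T : measurableType d} {T' : measurableType d'}
  (P : probability T R) (P' : probability T' R)
  (X : {RV P >-> R}) (X' : {RV P' >-> R}) (n : nat).
Hypothesis n_ge3 : (3 <= n)%N.
Hypothesis hX : has_student_distribution X n.
Hypothesis hX' : has_student_distribution X' n.+2.

Lemma standardized_student_cdf_add2 (y : R) : 0 < y ->
  y ^+ 2 * (2 * n%:R - 1) <= 3 * (n%:R - 2) ->
  student_cdf n.+2 (y * Num.sqrt (n.+2%:R / (n.+2%:R - 2))) <=
  student_cdf n (y * Num.sqrt (n%:R / (n%:R - 2))).
Proof.
move=> y0 hy.
have n0 : (0 < n)%N by rewrite (leq_trans _ n_ge3).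
have N3 : 3 <= n%:R :> R by rewrite ler_nat.
have scaled (m m' : R) : 0 <= m -> 0 <= m' ->
    y * Num.sqrt (m / m') = Num.sqrt m * (y / Num.sqrt m').
  by move=> m0 m'0; rewrite sqrtrM // sqrtrV // mulrCA.
have -> : n.+2%:R - 2 = n%:R :> R by rewrite -addn2 natrD addrK.
rewrite !scaled ?subr_ge0 ?(le_trans _ N3) ?ler_nat //.
set s := y / Num.sqrt (n%:R - 2); set t := y / Num.sqrt n%:R.
have t0 : 0 <= t by rewrite divr_ge0 ?sqrtr_ge0 // ltW.
have ts : t <= s.
  rewrite ler_wpM2l ?(ltW y0) // lef_pV2 ?posrE ?sqrtr_gt0; [|lra|lra].
  by rewrite ler_sqrt; lra.
rewrite (student_cdf_add2 n0 hX hX') addrC -lerBrDr.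
apply: le_trans (scaled_cdf_increment n0 hX t0 ts).
have -> : student_peak n / n%:R * t * student_kernel n t =
    student_peak n * (t / n%:R * student_kernel n t) :> R by ring.
rewrite -[leRHS]mulrA ler_pM2l ?(student_peak_gt0 n0 hX) //.
exact: student_kernel_gain.
Qed.

End Step.

(** The fraction (3m-8)(m-2) / (2m^2-6m+3) defining the threshold is at most
    3(m-2) / (2m-1), because (3m-8)(2m-1) <= 3(2m^2-6m+3), and the latter
    increases with m. *)
Lemma n0_threshold (R : realType) (y : R) (m n : nat) :
  n0_pred y m -> (m <= n)%N ->
  y ^+ 2 * (2 * n%:R - 1) <= 3 * (n%:R - 2).
Proof.
move=> /andP[m3 +] mn.
have : (3 : R) <= m%:R by rewrite ler_nat.
have : (m%:R : R) <= n%:R by rewrite ler_nat.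
move: (m%:R : R) (n%:R : R) (y ^+ 2) (sqr_ge0 y) => M N Y Y0 MN M3.
have d0 : 0 < 2 * M ^+ 2 - 6 * M + 3 by nra.
rewrite ltr_pdivlMr // => h.
have h1 : Y * (2 * M - 1) <= 3 * (M - 2).
  have -> : 3 * (M - 2) = Y * (2 * M - 1) + (3 * (M - 2) - Y * (2 * M - 1)) by ring.
  rewrite lerDl.
  have : 0 <= (3 * (M - 2) - Y * (2 * M - 1)) * (2 * M ^+ 2 - 6 * M + 3) by nra.
  by rewrite pmulr_lge0.
nra.
Qed.

Theorem theorem2p4 (R : realType)
    (d : nat -> measure_display)
    (T : forall n : nat, measurableType (d n))
    (P : forall n : nat, probability (T n) R)
    (X : forall n : nat, {RV (P n) >-> R})
    (hX : forall n : nat, (0 < n)%N -> has_student_distribution (X n) n)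
    (y : R) (hy : 0 < y < Num.sqrt 6 / 2) :
  ereal_inf
    [set P n [set w | y * Num.sqrt (fine ('V_(P n)[X n])%E)
                      <= `|X n w - fine ('E_(P n)[X n])%E|]
       | n in [set n : nat | (3 <= n)%N]]
  = (2 - 2 * max_nat 3 (n0 hy + 1)
               (fun n => student_cdf n (y * Num.sqrt (n%:R / (n%:R - 2)))))%:E.
Proof.
pose G (n : nat) : R := student_cdf n (y * Num.sqrt (n%:R / (n%:R - 2))).
rewrite -/G; set M := max_nat _ _ _.
have y0 : 0 < y by case/andP: (hy).
have tail n : (3 <= n)%N ->
    P n [set w | y * Num.sqrt (fine ('V_(P n)[X n])%E)
                 <= `|X n w - fine ('E_(P n)[X n])%E|] = (2 - 2 * G n)%:E.
  move=> n3; have n_gt0 : (0 < n)%N by rewrite (leq_trans _ n3).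
  have hXn := hX n n_gt0.
  rewrite (fine_expectation_student n_gt0 hXn) (variance_student n_gt0 hXn n3) /=.
  rewrite -(student_two_sided_tail n_gt0 hXn); last first.
    rewrite mulr_gt0 // sqrtr_gt0 divr_gt0 ?ltr0n // subr_gt0 ltr_nat //.
  by congr (P n _); apply/seteqP; split=> w /=; rewrite subr0.
have n0P : n0_pred y (n0 hy) by rewrite /n0; case: ex_minnP.
have n0_ge3 : (3 <= n0 hy)%N by case/andP: n0P.
have G_le n : (3 <= n)%N -> G n <= M.
  elim/ltn_ind: n => n IH n3.
  have [nb|nb] := leqP n (n0 hy + 1).
    rewrite /M /max_nat; apply: (@le_bigmax_seq _ R nat _ (G 3) n xpredT G) => //.
    by rewrite mem_index_iota n3 ltnS.
  case: n nb n3 IH => [//|[//|n]] nb n3 IH.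
  have n0n : (n0 hy <= n)%N by rewrite addn1 !ltnS in nb.
  have n_ge3 : (3 <= n)%N by rewrite (leq_trans n0_ge3).
  apply: le_trans (IH n _ n_ge3); last by rewrite ltnS leqnSn.
  apply: (standardized_student_cdf_add2 n_ge3 (hX _ _) (hX _ _)) => //.
  exact: n0_threshold n0P n0n.
have [i i3 MG] : exists2 i, (3 <= i)%N & M = G i.
  rewrite /M /max_nat big_nat_cond; elim/big_ind: _.
  - by exists 3%N.
  - move=> _ _ [i i3 ->] [j j3 ->]; rewrite /Num.max.
    by case: ifP => _; [exists j|exists i].
  - by move=> i /andP[/andP[i3 _] _]; exists i.
apply/eqP; rewrite eq_le; apply/andP; split.
  by apply: ereal_inf_lbound; exists i => //; rewrite tail // MG.
apply: le_ereal_inf_tmp => _ [n /= n3 <-].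
by rewrite tail // lee_fin lerB // ler_pM2l // G_le.
Qed.
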